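(* Let $\mathcal{A}\subset\mathbb{R}^n$ be a nonempty compact set, $\Xi\subseteq\mathbb{R}^n$, $V:\mathbb{R}^n\to\mathbb{R}_+$ and $\Psi:\mathbb{R}^n\rightrightarrows\mathbb{R}^n$, and assume one of the following two settings holds: (i) $\Xi$ is nonempty, closed and convex, $\mathcal{A}$ is convex, and $V(y)=\tfrac12\|y-\mathbf{P}_{\mathcal{A}}(y)\|^2$; (ii) $\Xi=\mathbb{R}^n$ and $V$ is continuously differentiable with locally Lipschitz gradient, positive definite and radially unbounded with respect to $\mathcal{A}$. Assume $\Psi$ is SPSP with respect to $V$ on $\Xi$, and that for every $\sigma>0$ there exists $B>0$ such that $\|s\|\le B$ for all $y\in\Xi\cap\bar B_\sigma(\mathcal{A})$ and all $s\in\Psi(y)$. Then $\mathcal{A}$ is SPAS for the iterative method $y^+=\mathbf{P}_\Xi[y-\alpha s]$, $s\in\Psi(y)$, with parameter $\alpha>0$.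
   Context: $\|\cdot\|$ is Euclidean; $\mathbf{P}_S$ is the orthogonal projection onto a nonempty closed convex set $S$. For compact $S$ and $r>0$: $\bar B_r(S)=\{x:\|x-\mathbf{P}_S(x)\|\le r\}$, $B_r(S)=\{x:\|x-\mathbf{P}_S(x)\|<r\}$ (distance to $S$). A function $V$ is positive definite w.r.t. a closed set $S$ if $V=0$ on $S$ and $V>0$ off $S$; it is radially unbounded w.r.t. $S$ (on a set $\Xi$) if for every $B\in\mathbb{R}$ there is $r>0$ with $V(x)>B$ for all $x$ (in $\Xi$) outside $\bar B_r(S)$. SPSP: Let $V:\mathbb{R}^n\to\mathbb{R}_+$ be differentiable, positive definite and radially unbounded w.r.t. compact $\mathcal{A}$, and let $\Xi$ strictly contain $\mathcal{A}$ (every point of $\mathcal{A}$ has an open ball around it contained in $\Xi$). $\Psi$ is semiglobally, practically, strictly pseudogradient (SPSP) w.r.t. $V$ on $\Xi$ if there exist $\epsilon\ge0$, $b\ge0$ such that $\nabla V(y)^Ts\ge -b$ for all $y\in\Xi\cap\bar B_\epsilon(\mathcal{A})$, $s\in\Psi(y)$, and for every $\sigma>\epsilon$ there is a continuous $\phi_{\sigma,\epsilon}:\mathbb{R}^n\to\mathbb{R}$, positive on $\Xi\cap(\bar B_\sigma(\mathcal{A})\setminus B_\epsilon(\mathcal{A}))$ and radially unbounded w.r.t. $\mathcal{A}$ on $\Xi$, with $\nabla V(y)^Ts\ge\phi_{\sigma,\epsilon}(y)$ for all $y\in\Xi\cap(\bar B_\sigma(\mathcal{A})\setminus B_\epsilon(\mathcal{A}))$,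 $s\in\Psi(y)$. SPAS (for the iteration with parameter $\alpha$; statements below concern every sequence $(y(t))_{t\in\mathbb{N}}$ with $y(0)\in\Xi$, $y(t+1)=\mathbf{P}_\Xi[y(t)-\alpha s(t)]$, $s(t)\in\Psi(y(t))$): $\mathcal{A}$ is practically stable if for some $\check\rho_s>0$ and every $\rho_s>\check\rho_s$ there exist $\delta>0$ and a nonempty set $P_s\subset(0,\infty)$ such that whenever $\alpha\in P_s$ and $y(0)\in\bar B_\delta(\mathcal{A})\cap\Xi$, $y(t)\in\bar B_{\rho_s}(\mathcal{A})\cap\Xi$ for all $t$. A compact $S$ is uniformly attractive on compact $\Omega$ if for every $\varepsilon>0$ with $\bar B_\varepsilon(S)\cap\Xi\subset\Omega\cap\Xi$ there is $T\in\mathbb{N}$ such that $y(t)\in\bar B_\varepsilon(S)$ whenever $y(0)\in\Omega$ and $t\ge T$. $\mathcal{A}$ is semiglobally practically attractive if for some $\check\rho_a>0$ and all $\sigma>\rho_a>\check\rho_a$ there is a nonempty $P_a\subset(0,\infty)$ such that whenever $\alpha\in P_a$, $\bar B_{\rho_a}(\mathcal{A})$ is uniformly attractive on $\bar B_\sigma(\mathcal{A})$. $\mathcal{A}$ is SPAS (semiglobally practically asymptotically stable) if it is practically stable and semiglobally practically attractive. *)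

(* Defs.v *)
From HB Require Import structures.
From mathcomp Require Import all_boot all_order all_algebra.
From mathcomp Require Import all_classical all_reals all_analysis.
Set Implicit Arguments. Unset Strict Implicit. Unset Printing Implicit Defensive.
Import Order.TTheory GRing.Theory Num.Theory.
Import numFieldNormedType.Exports.
Local Open Scope classical_set_scope.
Local Open Scope ring_scope.

Section Defs.
Context {R : realType} {n : nat}.
Local Notation vec := 'rV[R]_n.

Definition dotv (u v : vec) : R := \sum_(i < n) u 0 i * v 0 i.
Definition enorm (u : vec) : R := Num.sqrt (dotv u u).

Definition edist (x : vec) (S : set vec) : R := inf [set enorm (x - q) | q in S].

Definition ecball (r : R) (S : set vec) : set vec := [set x | edist x S <= r].
Definition eoball (r : R) (S : set vec) : set vec := [set x | edist x S < r].

(* orthogonal projection: a nearest point of S (unique when S is nonempty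
   closed convex); xget picks it *)
Definition is_proj (S : set vec) (x p : vec) : Prop :=
  S p /\ forall q, S q -> enorm (x - p) <= enorm (x - q).
Definition eproj (S : set vec) (x : vec) : vec := xget 0 [set p | is_proj S x p].

Definition egrad (V : vec -> R) (y : vec) : vec := \row_(i < n) ('d V y) (delta_mx 0 i).

Definition pos_def (V : vec -> R) (S : set vec) : Prop :=
  (forall x, S x -> V x = 0) /\ (forall x, ~ S x -> 0 < V x).

Definition rad_unbounded_on (V : vec -> R) (S Xi : set vec) : Prop :=
  forall B : R, exists2 r : R, 0 < r & forall x, Xi x -> ~ ecball r S x -> B < V x.

Definition strictly_contains (Xi A : set vec) : Prop :=
  forall a, A a -> exists2 r : R, 0 < r & forall x, enorm (x - a) < r -> Xi x.

Definition SPSP (A Xi : set vec) (V : vec -> R) (Psi : vec -> set vec) : Prop :=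
  [/\ (forall y, differentiable V y), pos_def V A, rad_unbounded_on V A setT,
      strictly_contains Xi A &
  exists eps b : R, [/\ 0 <= eps, 0 <= b,
    (forall y s, Xi y -> ecball eps A y -> Psi y s -> - b <= dotv (egrad V y) s) &
    (forall sigma, eps < sigma -> exists phi : vec -> R,
       [/\ continuous phi,
           (forall y, Xi y -> ecball sigma A y -> ~ eoball eps A y -> 0 < phi y),
           rad_unbounded_on phi A Xi &
           (forall y s, Xi y -> ecball sigma A y -> ~ eoball eps A y -> Psi y s ->
              phi y <= dotv (egrad V y) s)])]].

Definition trajectory (Xi : set vec) (Psi : vec -> set vec) (alpha : R)
  (y : nat -> vec) : Prop :=
  Xi (y 0%N) /\ forall t, exists2 s, Psi (y t) s & y t.+1 = eproj Xi (y t - alpha *: s).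

Definition practically_stable (A Xi : set vec) (Psi : vec -> set vec) : Prop :=
  exists2 rc : R, 0 < rc & forall rho, rc < rho ->
    exists2 delta : R, 0 < delta & exists Ps : set R,
      [/\ Ps !=set0, Ps `<=` [set a | 0 < a] &
      forall alpha y, Ps alpha -> trajectory Xi Psi alpha y ->
        ecball delta A (y 0%N) -> forall t, ecball rho A (y t) /\ Xi (y t)].

Definition unif_attractive (Xi : set vec) (Psi : vec -> set vec) (alpha : R)
  (S Om : set vec) : Prop :=
  forall e : R, 0 < e -> ecball e S `&` Xi `<=` Om `&` Xi ->
    exists T : nat, forall y, trajectory Xi Psi alpha y -> Om (y 0%N) ->
      forall t, (T <= t)%N -> ecball e S (y t).

Definition sg_practically_attractive (A Xi : set vec) (Psi : vec -> set vec) : Prop :=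
  exists2 rc : R, 0 < rc & forall sigma rho, rc < rho -> rho < sigma ->
    exists Pa : set R, [/\ Pa !=set0, Pa `<=` [set a | 0 < a] &
      forall alpha, Pa alpha -> unif_attractive Xi Psi alpha (ecball rho A) (ecball sigma A)].

Definition SPAS (A Xi : set vec) (Psi : vec -> set vec) : Prop :=
  practically_stable A Xi Psi /\ sg_practically_attractive A Xi Psi.

End Defs.

(* Main.v *)
(** [V] is a Lyapunov function along the iteration. In both settings, on every
    sublevel set and for small [alpha],
    [V y^+ <= V y - alpha <grad V y, s> + alpha eta] with [eta] as small as
    desired. In setting (i), [V] is dominated by half the squared distance to the
    projection of [y] on [A], with equality at [y], and projecting on [Xi] does
    not increase the distance to that point of [A]. In setting (ii), this is the
    mean value theorem with the local Lipschitz bounds, made uniform by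
    compactness. Outside the [eps]-neighbourhood of [A] the inner product is
    bounded below by some [2 m > 0] on the sublevel set, so [V] decreases by at
    least [alpha m]; inside that neighbourhood [V y^+] exceeds the local maximum
    of [V] by at most [1]. Hence [V] eventually drops below, and then stays
    below, a fixed level [c0], which yields both practical stability and
    attractivity. *)

Require Import Defs.
From HB Require Import structures.
From mathcomp Require Import all_boot all_order all_algebra.
From mathcomp Require Import all_classical all_reals all_analysis.
From mathcomp Require Import ring lra.
Import Order.TTheory GRing.Theory Num.Theory.
Import numFieldNormedType.Exports.
Local Open Scope classical_set_scope.
Local Open Scope ring_scope.

Set Implicit Arguments.
Unset Strict Implicit.

(** * Dot product and Euclidean norm *)

Section Euclidean.
Context {R : realType} {n : nat}.
Local Notation vec := 'rV[R]_n.
(* [edist] is also the extended distance of the topology library. *)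
Local Notation edist := Defs.edist.
Implicit Types (u v w x y p q : vec) (S : set vec) (a r : R).

Lemma dotvC u v : dotv u v = dotv v u.
Proof. by apply: eq_bigr => i _; rewrite mulrC. Qed.

Lemma dotvDl u v w : dotv (u + v) w = dotv u w + dotv v w.
Proof. by rewrite -big_split; apply: eq_bigr => i _; rewrite mxE mulrDl. Qed.

Lemma dotvZl a u v : dotv (a *: u) v = a * dotv u v.
Proof. by rewrite mulr_sumr; apply: eq_bigr => i _; rewrite mxE mulrA. Qed.

Lemma dotvNl u v : dotv (- u) v = - dotv u v.
Proof. by rewrite -scaleN1r dotvZl mulN1r. Qed.

Lemma dotvDr u v w : dotv w (u + v) = dotv w u + dotv w v.
Proof. by rewrite dotvC dotvDl !(dotvC w). Qed.

Lemma dotvZr a u v : dotv v (a *: u) = a * dotv v u.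
Proof. by rewrite dotvC dotvZl dotvC. Qed.

Lemma dotvNr u v : dotv v (- u) = - dotv v u.
Proof. by rewrite dotvC dotvNl dotvC. Qed.

Definition dotvE := (dotvDl, dotvDr, dotvNl, dotvNr, dotvZl, dotvZr).

Lemma dotvv_ge0 u : 0 <= dotv u u.
Proof. by apply: sumr_ge0 => i _; rewrite -expr2 sqr_ge0. Qed.

Lemma enorm_ge0 u : 0 <= enorm u.
Proof. exact: sqrtr_ge0. Qed.

Lemma sqr_enorm u : enorm u ^+ 2 = dotv u u.
Proof. by rewrite sqr_sqrtr // dotvv_ge0. Qed.

Lemma ler_enorm_sqr u v : (enorm u <= enorm v) = (dotv u u <= dotv v v).
Proof. by rewrite -!sqr_enorm ler_sqr // nnegrE enorm_ge0. Qed.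

Lemma coord_le_enorm u i : `|u 0 i| <= enorm u.
Proof.
rewrite -sqrtr_sqr ler_wsqrtr // /dotv (bigD1 i) //= -expr2 lerDl.
by apply: sumr_ge0 => j _; rewrite -expr2 sqr_ge0.
Qed.

Lemma enorm_eq0 u : enorm u = 0 -> u = 0.
Proof.
move=> u0; apply/rowP => i; rewrite mxE; apply/eqP.
by rewrite -normr_le0 -u0 coord_le_enorm.
Qed.

Lemma enorm0 : enorm (0 : vec) = 0.
Proof. by rewrite /enorm /dotv big1 ?sqrtr0 // => i _; rewrite mxE mul0r. Qed.

Lemma enormZ a u : enorm (a *: u) = `|a| * enorm u.
Proof.
by rewrite /enorm !dotvE mulrA -expr2 sqrtrM ?sqr_ge0 // sqrtr_sqr.
Qed.

Lemma enormN u : enorm (- u) = enorm u.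
Proof. by rewrite -scaleN1r enormZ normrN1 mul1r. Qed.

Lemma enormB u v : enorm (u - v) = enorm (v - u).
Proof. by rewrite -enormN opprB. Qed.

(** Cauchy-Schwarz: for nonzero vectors, expand the squared norm of [enorm u *: v - enorm v *: u]
    and cancel the positive factor [enorm u * enorm v]. *)
Lemma dotv_le_enorm u v : dotv u v <= enorm u * enorm v.
Proof.
have [|un0] := eqVneq (enorm u) 0.
  move/enorm_eq0 => ->; rewrite -(scale0r u) dotvZl mul0r.
  by rewrite mulr_ge0 // enorm_ge0.
have [|vn0] := eqVneq (enorm v) 0.
  move/enorm_eq0 => ->; rewrite -(scale0r u) dotvZr mul0r.
  by rewrite mulr_ge0 // enorm_ge0.
have uv0 : 0 < enorm u * enorm v by rewrite mulr_gt0 // lt_def enorm_ge0 ?un0 ?vn0.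
rewrite -(ler_pM2l uv0).
have := dotvv_ge0 (enorm u *: v - enorm v *: u).
rewrite !dotvE -!sqr_enorm (dotvC v u); nra.
Qed.

Lemma ler_enormD u v : enorm (u + v) <= enorm u + enorm v.
Proof.
rewrite -ler_sqr ?nnegrE ?addr_ge0 ?enorm_ge0 // sqr_enorm !dotvE (dotvC v u).
by have := dotv_le_enorm u v; rewrite -!sqr_enorm; lra.
Qed.

Lemma ler_dist_enorm u v w : enorm (u - w) <= enorm (u - v) + enorm (v - w).
Proof. by rewrite (le_trans _ (ler_enormD _ _)) // addrA subrK. Qed.

(** The ambient norm on row vectors is the maximum norm; this bound turns Euclidean boundedness into
    the boundedness that compactness requires. *)
Lemma mx_norm_le_enorm u : `|u| <= enorm u.
Proof.
rewrite [leLHS]mx_normrE; apply/bigmax_leP; split; first exact: enorm_ge0.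
by move=> [i j] _ /=; rewrite (ord1 i) coord_le_enorm.
Qed.

Lemma continuous_enorm : continuous (@enorm R n).
Proof.
have cdot : continuous (fun u : vec => dotv u u).
  apply: (@continuous_big R 'I_n +%R); first exact: add_continuous.
  by move=> i _ u; have c := @coord_continuous R 1 n 0 i u; exact: (cvgM c c).
by move=> u; apply: continuous_comp; [exact: cdot|exact: sqrt_continuous].
Qed.

Lemma continuous_dist_enorm x : continuous (fun y => enorm (x - y)).
Proof.
move=> y; apply: (@continuous_comp _ _ _ (fun y => x - y) (@enorm R n)).
  by apply: continuousB => //; exact: cst_continuous.
exact: continuous_enorm.
Qed.

Lemma near_enorm_lt x r : 0 < r -> \forall y \near x, enorm (y - x) < r.
Proof.
move=> r0.
have := @continuous_dist_enorm x x; rewrite /continuous_at subrr enorm0.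
by move=> /cvgr_lt /(_ _ r0); apply: filterS => y; rewrite enormB.
Qed.

(** * Distance to a set and compactness of its closed neighbourhoods *)

Lemma has_lbound_edist x S : has_lbound [set enorm (x - q) | q in S].
Proof. by exists 0 => _ [q _ <-]; exact: enorm_ge0. Qed.

Lemma edist_le x S q : S q -> edist x S <= enorm (x - q).
Proof. by move=> Sq; apply: ge_inf; [exact: has_lbound_edist|exists q]. Qed.

Lemma edist_ge x S r : S !=set0 -> (forall q, S q -> r <= enorm (x - q)) ->
  r <= edist x S.
Proof.
move=> [q0 Sq0] rS; apply: lb_le_inf; first by exists (enorm (x - q0)), q0.
by move=> _ [q Sq <-]; exact: rS.
Qed.

Lemma edist_in x S : S x -> edist x S = 0.
Proof.
move=> Sx; apply/eqP; rewrite eq_le.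
rewrite (le_trans (edist_le x Sx)) ?subrr ?enorm0 //=.
by apply: edist_ge; [exists x|move=> q _; exact: enorm_ge0].
Qed.

Lemma edist_lipschitz x y S : S !=set0 ->
  edist x S <= edist y S + enorm (x - y).
Proof.
move=> S0; rewrite -lerBlDr; apply: edist_ge => // q Sq.
rewrite lerBlDr addrC (le_trans (edist_le x Sq)) //; exact: ler_dist_enorm.
Qed.

Lemma continuous_edist S : S !=set0 -> continuous (edist^~ S).
Proof.
move=> S0 x; apply/(@cvgrPdist_lt R R^o _ (nbhs x)) => e e0.
apply: filterS (near_enorm_lt x e0) => y yx; rewrite ltr_norml.
have := edist_lipschitz x y S0; have := edist_lipschitz y x S0.
by rewrite (enormB x y); lra.
Qed.

Lemma compact_enorm_ball x r : compact [set y | enorm (x - y) <= r].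
Proof.
apply: bounded_closed_compact.
  exists (r + `|x|); split; first exact: num_real.
  move=> M rM y /= xy; rewrite -[y](subKr x) (le_trans (ler_normB _ _)) //.
  by have := mx_norm_le_enorm (x - y); lra.
apply: (@preimage_closed _ _ (fun y => enorm (x - y)) [set t | t <= r]); last exact: closed_le.
by move=> y _; exact: continuous_dist_enorm.
Qed.

Lemma compact_ecball S r : S !=set0 -> compact S -> compact (ecball r S).
Proof.
move=> S0 cS.
have [q0 Sq0] := S0.
have cl : closed (ecball r S).
  apply: (@preimage_closed _ _ (edist^~ S) [set t | t <= r]); last exact: closed_le.
  by move=> y _; exact: continuous_edist.
have [q1 Sq1 q1max] : exists2 q, q \in S & forall t, t \in S -> enorm (q0 - t) <= enorm (q0 - q).
  apply: compact_EVT_max => //.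
  exact/continuous_subspaceT/(@continuous_dist_enorm _).
(* [q1] is a point of [S] farthest from [q0], so this single ball around [q0] contains the whole
   [r]-neighbourhood. *)
apply: (subclosed_compact cl (@compact_enorm_ball q0 (enorm (q0 - q1) + r))).
move=> x /= xr; rewrite -lerBlDl; apply: (le_trans _ xr); apply: edist_ge => // q Sq.
have := q1max q; rewrite inE => /(_ Sq); have := ler_dist_enorm q0 q x.
by rewrite (enormB q x); lra.
Qed.

(** * Projection onto closed and convex sets *)

Lemma eprojP S x : S !=set0 -> closed S -> is_proj S x (eproj S x).
Proof.
move=> [q0 Sq0] clS; rewrite /eproj.
suff [p Sp] : exists p, is_proj S x p by apply: (xgetPex 0); exists p.
(* [S] may be unbounded: minimise over its compact part no farther from [x] than [q0]. *)
set K := S `&` [set y | enorm (x - y) <= enorm (x - q0)].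
have cK : compact K by rewrite /K setIC; apply: compact_closedI => //; exact: compact_enorm_ball.
have [||p] := @compact_EVT_min _ _ (fun y => enorm (x - y)) K _ cK.
- by exists q0; split => /=.
- exact/continuous_subspaceT/(@continuous_dist_enorm _).
rewrite inE => -[Sp pq0] pmin; exists p; split => // q Sq.
have [qq0|q0q] := leP (enorm (x - q)) (enorm (x - q0)).
  by apply: pmin; rewrite inE; split.
exact: le_trans pq0 (ltW q0q).
Qed.

Lemma eproj_id S x : S x -> eproj S x = x.
Proof.
move=> Sx; have [Sp pmin] : is_proj S x (eproj S x).
  apply: (xgetPex 0); exists x; split => // q _.
  by rewrite subrr enorm0 enorm_ge0.
have := pmin x Sx; rewrite subrr enorm0 => p0.
apply/esym/eqP; rewrite -subr_eq0; apply/eqP/enorm_eq0/eqP.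
by rewrite eq_le p0 enorm_ge0.
Qed.

Lemma le0_of_le_scale (b c : R) : (forall t, 0 < t -> t <= 1 -> b <= t * c) -> b <= 0.
Proof.
move=> H; rewrite leNgt; apply/negP => b0.
have bc : b <= c by have := H 1 ltr01 (lexx _); rewrite mul1r.
have c0 : 0 < c by lra.
(* This [t] lies in the allowed range because [b <= c], and it yields [b <= b / 2]. *)
have := H (b / (2 * c)).
rewrite divr_gt0 ?mulr_gt0 // ler_pdivrMr ?mulr_gt0 //.
have -> : b / (2 * c) * c = b / 2 by field; lra.
by move=> /(_ isT) H1; have := H1 ltac:(lra); lra.
Qed.

(** Moving from [p] towards [q] by a fraction [t] cannot shorten the distance to [x]; the
    first-order term in [t] gives the sign. *)
Lemma proj_dot_le0 S x p q : convex_set S -> is_proj S x p -> S q ->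
  dotv (x - p) (q - p) <= 0.
Proof.
move=> cS [Sp pmin] Sq.
have : 2 * dotv (x - p) (q - p) <= 0; last by lra.
apply: (@le0_of_le_scale _ (dotv (q - p) (q - p))) => t t0 t1.
have St : S (p + t *: (q - p)).
  have -> : p + t *: (q - p) = t *: q + (1 - t) *: p.
    by rewrite scalerBr scalerBl scale1r addrCA.
  exact/set_mem/(cS q p (Itv01 (ltW t0) t1) (mem_set Sq) (mem_set Sp)).
have := pmin _ St; rewrite ler_enorm_sqr opprD addrA.
move: (x - p) (q - p) => u w; rewrite !dotvE (dotvC w u) => H.
rewrite -(ler_pM2l t0); nra.
Qed.

Lemma proj_nonexpansive S x q : closed S -> convex_set S -> S q ->
  enorm (eproj S x - q) <= enorm (x - q).
Proof.
move=> clS cS Sq; have pP := @eprojP S x (ex_intro _ q Sq) clS.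
have := proj_dot_le0 cS pP Sq; set p := eproj S x.
have -> : x - q = (x - p) - (q - p) by rewrite opprB addrA subrK.
rewrite -enormN opprB ler_enorm_sqr.
have := dotvv_ge0 (x - p).
move: (x - p) (q - p) => u w; rewrite !dotvE (dotvC w u); lra.
Qed.

End Euclidean.

(** * From a uniform descent inequality to SPAS *)

Section Lyapunov.
Context {R : realType} {n : nat}.
Local Notation vec := 'rV[R]_n.
Local Notation edist := Defs.edist.
Context (A Xi : set vec) (V : vec -> R) (Psi : vec -> set vec).

(** The threshold on [a] is uniform in [y] and [s]; [a * eta] absorbs the second-order term of the
    step. *)
Definition uniform_descent := forall sigma B eta : R, 0 < B -> 0 < eta ->
  \forall a \near 0^'+, forall y s, Xi y -> ecball sigma A y -> enorm s <= B ->
    V (eproj Xi (y - a *: s)) <= V y - a * dotv (egrad V y) s + a * eta.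

Context (A0 : A !=set0) (cA : compact A) (Xi0 : Xi !=set0) (clXi : closed Xi).

Lemma continuous_ecball_bounded r : continuous V ->
  exists c, forall x, ecball r A x -> V x <= c.
Proof.
move=> cV; have [->|/set0P K0] := eqVneq (ecball r A) set0; first by exists 0.
have [x _ xmax] := compact_EVT_max K0 (@compact_ecball _ _ A r A0 cA)
  (continuous_subspaceT cV).
by exists (V x) => y Ky; apply: xmax; rewrite inE.
Qed.

(** A continuous positive function attains its minimum on the compact shell; an empty shell gets the
    default value 1. *)
Lemma strict_pseudogradient_gap (phi : vec -> R) eps sigma : continuous phi ->
  (forall y, Xi y -> ecball sigma A y -> ~ eoball eps A y -> 0 < phi y) ->
  exists2 m, 0 < m &
    forall y, Xi y -> ecball sigma A y -> ~ eoball eps A y -> m <= phi y.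
Proof.
move=> cphi phi0; set K := ecball sigma A `&` (Xi `&` ~` eoball eps A).
have [K0|/set0P K0] := eqVneq K set0.
  by exists 1 => // y Xy sy ey; have : set0 y by rewrite -K0.
have cK : compact K.
  apply: compact_closedI; first exact: compact_ecball.
  apply: closedI => //; rewrite closedC.
  apply: (@open_comp _ _ (edist^~ A) [set t | t < eps]); last exact: open_lt.
  by move=> y _; exact: continuous_edist.
have [x] := compact_EVT_min K0 cK (continuous_subspaceT cphi).
rewrite inE => -[sx [Xx ex]] xmin; exists (phi x); first exact: phi0.
by move=> y Xy sy ey; apply: xmin; rewrite inE.
Qed.

Lemma trajectory_in alpha y : trajectory Xi Psi alpha y -> forall t, Xi (y t).
Proof.
move=> [y0 yS] [//|t]; have [s _ ->] := yS t.
by have [] := eprojP (y t - alpha *: s) Xi0 clXi.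
Qed.

(** Since [c0 <= c], the bound itself keeps the trajectory in the sublevel set of [c], where the
    one-step estimate applies again. *)
Lemma trajectory_decrease alpha y (c0 c m : R) :
  c0 <= c -> 0 <= alpha -> 0 <= m ->
  (forall z s, Xi z -> Psi z s -> V z <= c ->
    V (eproj Xi (z - alpha *: s)) <= Num.max c0 (V z - alpha * m)) ->
  trajectory Xi Psi alpha y -> V (y 0%N) <= c ->
  forall t, V (y t) <= Num.max c0 (c - t%:R * (alpha * m)).
Proof.
move=> c0c a0 m0 step tr y0; have Xy := trajectory_in tr.
have am0 : 0 <= alpha * m by rewrite mulr_ge0.
elim=> [|t IH]; first by rewrite mul0r subr0 le_max y0 orbT.
have [s Ps ->] := tr.2 t.
have yc : V (y t) <= c.
  by rewrite (le_trans IH) // ge_max c0c gerBl mulr_ge0.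
apply: le_trans (step _ _ (Xy t) Ps yc) _; rewrite ge_max le_max lexx /=.
rewrite -natr1 mulrDl mul1r; move: IH; rewrite !le_max => /orP[]H; apply/orP.
  by left; lra.
by right; lra.
Qed.

Context (hb : forall sigma : R, 0 < sigma -> exists2 B : R, 0 < B &
  forall y s, Xi y -> ecball sigma A y -> Psi y s -> enorm s <= B).

(** The level [c0] is fixed before [c]: only the rate [m] and the admissible steps depend on the
    sublevel set. *)
Lemma descent_step : uniform_descent -> SPSP A Xi V Psi ->
  exists c0 : R, (exists2 delta, 0 < delta & forall x, ecball delta A x -> V x <= c0) /\
    forall c, exists2 m, 0 < m & \forall a \near 0^'+, forall y s, Xi y ->
      Psi y s -> V y <= c ->
      V (eproj Xi (y - a *: s)) <= Num.max c0 (V y - a * m).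
Proof.
move=> desc [dV _ rV _ [eps [b [eps0 b0 grad_ge strict]]]].
have cV : continuous V by move=> x; exact: differentiable_continuous.
(* The margin [1] makes room for a positive [delta] when [eps = 0]. *)
have [c0 Vc0] := continuous_ecball_bounded (eps + 1) cV.
(* The added 1 pays for the possible increase of [V] in a step starting inside the
   [eps]-neighbourhood. *)
exists (c0 + 1); split.
  by exists 1 => // x x1; rewrite (le_trans (Vc0 x _)) /ecball/=; move: x1; rewrite /ecball/=; lra.
move=> c; have [r r0 rc] := rV c.
(* Larger than [eps], as [strict] demands, and than [r], so that the sublevel set of [c] fits in
   [ecball sigma A]. *)
set sigma := eps + r + 1.
have Vsigma y : V y <= c -> ecball sigma A y.
  move=> yc; have [//|ny] := pselect (ecball r A y).
    by rewrite /ecball /= /sigma; lra.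
  by have := rc y I ny; rewrite ltNge yc.
have [phi [cphi phi0 _ phi_le]] := strict sigma ltac:(rewrite /sigma; lra).
have [m m0 mphi] := strict_pseudogradient_gap cphi phi0.
have [B B0 sB] := hb (ltac:(rewrite /sigma; lra) : 0 < sigma).
have m20 : 0 < m / 2 by rewrite divr_gt0.
(* Half of the gap [m] is spent on the error [eta]; the other half remains as the decrease rate. *)
exists (m / 2) => //; near=> a.
have a0 : 0 < a by [].
have ab : a * (b + m / 2) <= 1.
  rewrite -ler_pdivlMr; last lra.
  near: a; apply: nbhs_right_le; rewrite divr_gt0 //; lra.
move=> y s Xy Ps yc; have Ky := Vsigma y yc; have sB' := sB y s Xy Ky Ps.
have H : V (eproj Xi (y - a *: s)) <= V y - a * dotv (egrad V y) s + a * (m / 2).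
  by move: y s Xy Ky sB' {Ps yc}; near: a; exact: desc.
have [ye|ye] := pselect (eoball eps A y).
  have ye' : ecball eps A y by exact: ltW.
  have := grad_ge y s Xy ye' Ps.
  have : V y <= c0 by apply: Vc0; rewrite /ecball /=; move: ye'; rewrite /ecball/=; lra.
  by rewrite le_max; move=> *; apply/orP; left; nra.
have := phi_le y s Xy Ky ye Ps; have := mphi y Xy Ky ye.
by rewrite le_max => *; apply/orP; right; nra.
Unshelve. all: by end_near. Qed.

Lemma SPAS_of_descent : uniform_descent -> SPSP A Xi V Psi -> SPAS A Xi Psi.
Proof.
move=> desc spsp; have [dV _ rV _ _] := spsp.
have cV : continuous V by move=> x; exact: differentiable_continuous.
have [c0 [[delta delta0 Vdelta] step]] := descent_step desc spsp.
have [rc rc0 Vrc] := rV c0.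
have sub rho y : rc < rho -> V y <= c0 -> ecball rho A y.
  move=> rcr yc; have [|ny] := pselect (ecball rc A y).
    by rewrite /ecball /=; lra.
  by have := Vrc y I ny; rewrite ltNge yc.
split; exists rc => //.
  move=> rho rcr; exists delta => //; have [m m0 mstep] := step c0.
  exists [set a | 0 < a /\ forall y s, Xi y -> Psi y s -> V y <= c0 ->
      V (eproj Xi (y - a *: s)) <= Num.max c0 (V y - a * m)]; split.
  - apply: (@filter_ex _ (0^'+ : set_system R)).
    by near=> a; split => //; near: a.
  - by move=> a [].
  - move=> a y [a0 astep] tr y0 t; split; last exact: (trajectory_in tr).
    apply: sub => //.
    apply: le_trans (trajectory_decrease (lexx c0) (ltW a0) (ltW m0) astep tr (Vdelta _ y0) t) _.
    by rewrite ge_max lexx gerBl !mulr_ge0 // ltW.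
move=> sigma rho rcr rhos.
have [c Vc] := continuous_ecball_bounded sigma cV.
pose c1 := Num.max c0 c.
have [m m0 mstep] := step c1.
exists [set a | 0 < a /\ forall y s, Xi y -> Psi y s -> V y <= c1 ->
    V (eproj Xi (y - a *: s)) <= Num.max c0 (V y - a * m)]; split.
- apply: (@filter_ex _ (0^'+ : set_system R)).
  by near=> a; split => //; near: a.
- by move=> a [].
move=> a [a0 astep] e e0 _.
have am0 : 0 < a * m by rewrite mulr_gt0.
(* Enough decreases of size [a * m] to descend from [c1] to [c0]. *)
exists (Num.bound ((c1 - c0) / (a * m))) => y tr y0 t Tt.
have c01 : c0 <= c1 by rewrite le_max lexx.
have yc1 : V (y 0%N) <= c1 by rewrite le_max Vc ?orbT.
have H := trajectory_decrease c01 (ltW a0) (ltW m0) astep tr yc1 t.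
(* The trajectory enters [ecball rho A] itself, where the distance to that set is 0. *)
suff : ecball rho A (y t) by move=> /edist_in; rewrite /ecball /= => ->; exact: ltW.
apply: sub => //; apply: le_trans H _; rewrite ge_max lexx /=.
have : (c1 - c0) / (a * m) <= t%:R.
  apply/ltW/(lt_le_trans (archi_boundP _)); last by rewrite ler_nat.
  by rewrite divr_ge0 ?subr_ge0 // ltW.
by rewrite ler_pdivrMr //; lra.
Unshelve. all: by end_near. Qed.

End Lyapunov.

(** * Descent for half the squared distance *)

Section Gradient.
Context {R : realType} {n : nat}.
Local Notation vec := 'rV[R]_n.
Implicit Types (V : vec -> R) (A Xi : set vec).

Lemma dotv_egrad V y h : dotv (egrad V y) h = 'd V y h.
Proof.
rewrite [in RHS](row_sum_delta h) linear_sum; apply: eq_bigr => i _.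
by rewrite linearZ /= mxE mulrC.
Qed.

(** The right difference quotients along [h] are at most [dotv g h] plus a multiple of [t]; let [t]
    tend to 0. *)
Lemma diff_le_of_quadratic_bound V y g h : differentiable V y ->
  (forall k, V (y + k) <= V y + dotv g k + 2^-1 * dotv k k) ->
  'd V y h <= dotv g h.
Proof.
move=> dV ub.
have dVh : (fun t => t^-1 *: ((V \o shift y) (t *: h) - V y)) t @[t --> 0^'+]
    --> 'd V y h.
  apply: cvg_dnbhs_at_right; rewrite -deriveE //.
  exact: diff_derivable.
have lin : (fun t : R => dotv g h + t * (2^-1 * dotv h h)) t @[t --> 0^'+] --> dotv g h.
  rewrite -[X in _ --> X]addr0 -[X in _ + X](mul0r (2^-1 * dotv h h)).
  apply: cvgD; first exact: cvg_cst.
  apply: cvgMr_tmp; exact: cvg_at_right_filter.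
apply: (ler_cvg_to dVh lin); near=> t.
have t0 : 0 < t by [].
have := ub (t *: h); rewrite /= addrC !dotvE => H.
rewrite /GRing.scale /= ler_pdivrMl //; nra.
Unshelve. all: by end_near. Qed.

Lemma egrad_of_quadratic_bound V y g h : differentiable V y ->
  (forall k, V (y + k) <= V y + dotv g k + 2^-1 * dotv k k) ->
  dotv (egrad V y) h = dotv g h.
Proof.
move=> dV ub; rewrite dotv_egrad; apply/eqP; rewrite eq_le.
rewrite (diff_le_of_quadratic_bound _ dV ub) /=.
by have := diff_le_of_quadratic_bound (- h) dV ub; rewrite linearN dotvE lerN2.
Qed.

(** The quadratic centred at the projection [p] of [y] dominates [V] and touches it at [y], so the
    gradient is [y - p] without differentiating the projection. The same [p] bounds [V] after the
    step, with error [a ^+ 2 * dotv s s / 2]. *)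
Lemma uniform_descent_half_sqr_dist A Xi V : A !=set0 -> closed A -> A `<=` Xi ->
  closed Xi -> convex_set Xi -> (forall y, differentiable V y) ->
  (forall y, V y = 2^-1 * enorm (y - eproj A y) ^+ 2) ->
  uniform_descent A Xi V.
Proof.
move=> A0 clA AXi clXi cXi dV VE sigma B eta B0 eta0.
have Vle x q : A q -> V x <= 2^-1 * dotv (x - q) (x - q).
  move=> Aq; rewrite VE sqr_enorm ler_pM2l ?invr_gt0 // -ler_enorm_sqr.
  by have [_] := eprojP x A0 clA; exact.
near=> a; have a0 : 0 < a by [].
have aB : a * B ^+ 2 <= eta.
  rewrite -ler_pdivlMr ?exprn_gt0 //.
  by near: a; apply: nbhs_right_le; rewrite divr_gt0 ?exprn_gt0.
move=> y s Xy _ sB; set p := eproj A y.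
have [Ap _] : is_proj A y p by exact: eprojP.
have Vy : V y = 2^-1 * dotv (y - p) (y - p) by rewrite VE sqr_enorm.
have -> : dotv (egrad V y) s = dotv (y - p) s.
  apply: egrad_of_quadratic_bound => // k.
  apply: le_trans (Vle _ _ Ap) _; rewrite Vy addrAC.
  by move: (y - p) => u; rewrite !dotvE (dotvC k u); lra.
apply: le_trans (Vle _ _ Ap) _.
have := proj_nonexpansive (y - a *: s) clXi cXi (AXi _ Ap).
rewrite ler_enorm_sqr Vy addrAC.
have : dotv s s <= B ^+ 2 by rewrite -sqr_enorm ler_sqr ?nnegrE ?enorm_ge0 // ltW.
move: (y - p) (eproj Xi _ - p) => u w; rewrite !dotvE (dotvC s u) => sB2 wu.
by nra.
Unshelve. all: by end_near. Qed.

(** * Descent for a locally Lipschitz gradient *)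

Lemma segment_MVT V y h : (forall x, differentiable V x) ->
  exists c, [/\ 0 < c, c < 1 & V (y + h) - V y = dotv (egrad V (y + c *: h)) h].
Proof.
move=> dV; pose g t := V (y + t *: h).
have gE t : (fun s : R => s^-1 *: ((g \o shift t) (s *: 1) - g t)) =
    (fun s => s^-1 *: ((V \o shift (y + t *: h)) (s *: h) - V (y + t *: h))).
  by apply/funext => s; rewrite /g /= [s *: 1]mulr1 scalerDl addrCA.
have dg t : is_derive t (1 : R) g ('d V (y + t *: h) h).
  apply: DeriveDef.
    by rewrite /derivable gE; exact: diff_derivable.
  by rewrite /derive gE -/('D_h V (y + t *: h)) deriveE.
have cg : {within `[0, 1], continuous g}.
  apply: derivable_within_continuous => t _; by have [] := dg t.
have [c c01] := MVT ltr01 (fun t _ => dg t) cg.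
rewrite /g scale1r scale0r addr0 subr0 mulr1 -dotv_egrad => E.
by exists c; move: c01; rewrite in_itv /= => /andP[].
Qed.

Lemma uniform_descent_locally_lipschitz A V : A !=set0 -> compact A ->
  (forall y, differentiable V y) ->
  (forall y0, exists2 r : R, 0 < r & exists L : R, forall y1 y2,
    enorm (y1 - y0) < r -> enorm (y2 - y0) < r ->
    enorm (egrad V y1 - egrad V y2) <= L * enorm (y1 - y2)) ->
  uniform_descent A setT V.
Proof.
move=> A0 cA dV lip sigma B eta B0 eta0.
(* Near-covering compactness: an estimate valid for [y] near each [y0] and [a] near 0 holds for one
   range of [a] on the whole ball. *)
have /compact_near_coveringP cov := @compact_ecball _ _ A sigma A0 cA.
suff H : \forall a \near 0^'+, ecball sigma A `<=` [set y | forall s, enorm s <= B ->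
    V (y - a *: s) <= V y - a * dotv (egrad V y) s + a * eta].
  by apply: filterS H => a Ka y s _ Ky sB; rewrite eproj_id //; exact: Ka.
apply: (cov R (0^'+) (fun a y => forall s, enorm s <= B ->
    V (y - a *: s) <= V y - a * dotv (egrad V y) s + a * eta)) => y0 _.
have [r r0 [L Llip]] := lip y0.
(* [L] may be negative or zero: the absolute value and the added 1 give a positive divisor. *)
have LB : 0 < `|L| * B ^+ 2 + 1 by rewrite ltr_wpDl // mulr_ge0 // sqr_ge0.
have r2 : 0 < r / 2 by rewrite divr_gt0.
(* Both the start and the step stay below [r / 2], so the mean value point [z] remains in the
   Lipschitz ball of radius [r]. *)
exists ([set y | enorm (y - y0) < r / 2],
        [set a | [/\ 0 < a, a * B < r / 2 & a * (`|L| * B ^+ 2) <= eta]]).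
  split => /=; first exact: near_enorm_lt.
  near=> a; split => //.
    rewrite -ltr_pdivlMr //; near: a; apply: nbhs_right_lt; exact: divr_gt0.
  have a0 : 0 < a by [].
  have : a <= eta / (`|L| * B ^+ 2 + 1).
    by near: a; apply: nbhs_right_le; rewrite divr_gt0.
  by rewrite ler_pdivlMr //; lra.
move=> [y a] /= [yy0 [a0 aB aL]] s sB.
have [c [c0 c1]] := segment_MVT y (- (a *: s)) dV.
set z := y + c *: _ => zE.
have asB : enorm (a *: s) <= a * B by rewrite enormZ gtr0_norm // ler_pM2l.
have zy : z - y = - ((c * a) *: s) by rewrite /z addrC addKr scalerN scalerA.
clearbody z.
have zyn : enorm (z - y) <= a * B.
  rewrite zy enormN -scalerA enormZ gtr0_norm // (le_trans _ asB) //.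
  by rewrite ler_piMl ?enorm_ge0 // ltW.
have zy0 : enorm (z - y0) < r.
  by have := ler_dist_enorm z y y0; lra.
have yy0' : enorm (y - y0) < r by lra.
have zyL : enorm (egrad V z - egrad V y) <= `|L| * (a * B).
  apply: le_trans (Llip _ _ zy0 yy0') _.
  apply: le_trans (ler_wpM2r (enorm_ge0 _) (ler_norm L)) _.
  exact: ler_wpM2l.
have := dotv_le_enorm (egrad V z - egrad V y) (- (a *: s)).
have : enorm (egrad V z - egrad V y) * enorm (- (a *: s)) <= (`|L| * (a * B)) * (a * B).
  by apply: ler_pM; rewrite ?enorm_ge0 // enormN.
have : a * (a * (`|L| * B ^+ 2)) <= a * eta by rewrite ler_pM2l.
have -> : `|L| * (a * B) * (a * B) = a * (a * (`|L| * B ^+ 2)) by ring.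
move: zE; move: (V _) (V y) => V1 V0; move: (egrad V z) (egrad V y) => gz gy.
rewrite !dotvE; move: (enorm _ * enorm _) => e.
lra.
Unshelve. all: by end_near. Qed.

End Gradient.

Unset Implicit Arguments.
Set Strict Implicit.

Theorem theorem2 (R : realType) (n : nat) (A Xi : set 'rV[R]_n)
  (V : 'rV[R]_n -> R) (Psi : 'rV[R]_n -> set 'rV[R]_n) :
  A !=set0 -> compact A ->
  (forall y, 0 <= V y) ->
  ( (Xi !=set0 /\ closed Xi /\ convex_set Xi /\ convex_set A /\
       (forall y, V y = 2^-1 * enorm (y - eproj A y) ^+ 2))
    \/
    (Xi = setT /\
     (forall y, differentiable V y) /\
     (forall s, continuous (fun y => 'd V y s)) /\
     (forall y0, exists2 r : R, 0 < r & exists L : R, forall y1 y2,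
        enorm (y1 - y0) < r -> enorm (y2 - y0) < r ->
        enorm (egrad V y1 - egrad V y2) <= L * enorm (y1 - y2)) /\
     pos_def V A /\ rad_unbounded_on V A setT) ) ->
  SPSP A Xi V Psi ->
  (forall sigma : R, 0 < sigma -> exists2 B : R, 0 < B &
     forall y s, Xi y -> ecball sigma A y -> Psi y s -> enorm s <= B) ->
  SPAS A Xi Psi.
Proof.
move=> A0 cA _ settings spsp hb; have [dV _ _ sXi _] := spsp.
have AXi : A `<=` Xi.
  by move=> a Aa; have [r r0 Xr] := sXi a Aa; apply: Xr; rewrite subrr enorm0.
case: settings => [[Xi0 [clXi [cXi [_ VE]]]]|[XiE [_ [_ [lip _]]]]].
  apply: (SPAS_of_descent A0 cA Xi0 clXi hb _ spsp).
  apply: (uniform_descent_half_sqr_dist A0 _ AXi clXi cXi dV VE).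
  by apply: compact_closed => //; exact: norm_hausdorff.
subst Xi; have T0 : [set: 'rV[R]_n] !=set0 by exists 0.
apply: (SPAS_of_descent A0 cA T0 closedT hb _ spsp).
exact: (uniform_descent_locally_lipschitz A0 cA dV lip).
Qed.
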